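(* Let $\Pi$ be a program without set atoms in the heads of its rules. Then there are no $\mathcal{A}log$ answer sets $A_1, A_2$ of $\Pi$ such that $A_1\subset A_2$ (proper inclusion). Similarly, there are no $\mathcal{S}log^+$ answer sets $A_1,A_2$ of $\Pi$ such that $A_1\subset A_2$ (proper inclusion).
   Context: **Syntax (common to $\mathcal{A}log$ and $\mathcal{S}log^+$; programs without set atoms in heads).** Let $\Sigma$ be a signature with finitely many predicate and function symbols and a possibly infinite collection of object constants. Let $\mathcal{F}$ be a finite collection of symbols denoting (possibly partial) functions from sets of (tuples of) ground terms of $\Sigma$ into integers (e.g. $card$, which is undefined on infinite sets, and $min$). Terms, atoms $p(\bar t)$ and literals ($p(\bar t)$ or its classical negation $\neg p(\bar t)$) over $\Sigma$ are called regular; they are ground if they contain no variables and no arithmetic function symbols. A set name is an expression $\{\bar X:cond\}$ where $cond$ is a finite collection of regular literals and $\bar X$ is the list of variables occurring in $cond$; $cond(\bar t)$ denotes the set of ground literals obtained by substituting ground terms $\bar t$ for $\bar X$. A set atom is an expression of the form $f_1(S_1)\odot f_2(S_2)$, $f(S)\odot k$, or $S_1\otimes S_2$, where $f,f_1,f_2\in\mathcal{F}$, $S,S_1,S_2$ are set names, $k$ is a number, $\odot\in\{>,\ge,<,\le,=,\ne\}$ and $\otimes\in\{\subset,\subseteq,=\}$. In set atoms, a predicate symbol $p$ used as a set abbreviates $\{\bar X:p(\bar X)\}$. A rule without set atoms in its head is an expression $head\leftarrow body$, where $head$ is a (possibly empty, possibly infinite) disjunction of regular literals and $body$ is a (possibly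 empty, possibly infinite) collection of regular literals, possibly preceded by default negation $not$, and set atoms. A program is a collection of rules. All variables are bound in set names (rules with other variables are shorthand for their ground instantiations), so programs are ground. **Satisfaction.** Let $A$ be a set of ground regular literals. A regular literal $l$ is true in $A$ iff $l\in A$; $not\ l$ is true iff $l\notin A$. A disjunction is true iff one of its literals is in $A$ (the empty head is never true). A set atom is evaluated in $A$ by interpreting each set name $\{\bar X:cond\}$ as the set $\{\bar t: cond(\bar t)\subseteq A\}$: it is undefined in $A$ if some function in it is undefined on the corresponding set; otherwise it is true or false according to the resulting (in)equality or set relation. A rule is satisfied by $A$ if its head is true in $A$ or its body is false or undefined in $A$ (i.e. not all elements of the body are true). **Answer sets of programs without set atoms.** If a program contains neither $not$ nor set atoms, its answer sets are the subset-minimal consistent sets of ground literals satisfying all its rules. For a program $\Pi$ with $not$ but no set atoms, $A$ is an answer set of $\Pi$ iff $A$ is an answer set of the program obtained from $\Pi$ by deleting each rule containing $not\ l$ with $l\in A$ and deleting all remaining expressions $not\ l$. Rules may be infinite. **$\mathcal{A}log$ set reduct.** The $\mathcal{A}log$ set reduct of $\Pi$ with respect to $A$ is obtained by (1) removing rules containing set atoms that are false or undefined in $A$; (2) replacing every remaining set atom $SA$ by the union of all $cond(\bar t)$ such that $\{\bar X:cond(\bar X)\}$ occurs in $SA$ and $cond(\bar t)\subseteq A$. **Minimal support.** For vectors $\bar W=(W_1,\dots,W_n)$, $\bar V=(V_1,\dots,V_n)$ of sets of ground regular literals, $\bar W\le\bar V$ means $W_i\subseteq V_i$ for all $i$, and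 $\bar W<\bar V$ means $\bar W\le\bar V$ and $\bar W\ne\bar V$. A set atom $C(\{\bar X:cond_1\},\dots,\{\bar X:cond_n\})$ with $n$ set names is satisfied by $\bar W$ if $C(\{\bar t:cond_1(\bar t)\subseteq W_1\},\dots,\{\bar t:cond_n(\bar t)\subseteq W_n\})$ is true. $\bar W$ is a minimal support for $C$ in $A$ if: (i) $W_i\subseteq A$ for every $i$; (ii) every $\bar V$ with $W_i\subseteq V_i\subseteq A$ for all $i$ satisfies $C$; (iii) no $\bar U<\bar W$ satisfies (i) and (ii). **$\mathcal{S}log^+$ set reduct.** An $\mathcal{S}log^+$ set reduct of $\Pi$ with respect to $A$ is any program obtained by (1) removing rules containing set atoms that are false or undefined in $A$; (2) replacing every remaining set atom occurrence $C$ in the body of a rule by the union of the coordinates of one of its minimal supports in $A$ (choices made independently, so there may be several set reducts). **Answer sets (no set atoms in heads).** $A$ is an $\mathcal{A}log$ answer set of $\Pi$ iff $A$ is an answer set of the $\mathcal{A}log$ set reduct of $\Pi$ with respect to $A$. $A$ is an $\mathcal{S}log^+$ answer set of $\Pi$ iff $A$ is an answer set of some $\mathcal{S}log^+$ set reduct of $\Pi$ with respect to $A$. *)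

(* Defs.v *)
From HB Require Import structures.
From Stdlib Require List.
From mathcomp Require Import all_boot all_order all_algebra.
From mathcomp Require Import boolp classical_sets.

Set Implicit Arguments.
Unset Strict Implicit.
Unset Printing Implicit Defensive.

Local Open Scope classical_set_scope.

(* The function symbols are split into the ordinary ones ([fsym]), which build
   ground terms, and the arithmetic ones ([asym]), which do not occur in ground
   terms and denote partial operations on object constants (the numbers being
   among the object constants). *)
Record signature := Signature {
  psym : finType; psym_ar : psym -> nat;
  fsym : finType; fsym_ar : fsym -> nat;
  asym : finType; asym_ar : asym -> nat;
  cst : Type;
  asym_val : forall a : asym, {ffun 'I_(asym_ar a) -> cst} -> option cst }.

Inductive term (Sg : signature) : Type :=
| TVar of nat
| TCst of cst Sg
| TFun (f : fsym Sg) of {ffun 'I_(fsym_ar f) -> term Sg}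
| TArith (a : asym Sg) of {ffun 'I_(asym_ar a) -> term Sg}.

Inductive gterm (Sg : signature) : Type :=
| GCst of cst Sg
| GFun (f : fsym Sg) of {ffun 'I_(fsym_ar f) -> gterm Sg}.

Arguments TVar {Sg} _.
Arguments TCst {Sg} _.
Arguments TFun {Sg} f _.
Arguments TArith {Sg} a _.
Arguments GCst {Sg} _.
Arguments GFun {Sg} f _.

(* [Lit true p ts] is p(ts), [Lit false p ts] its classical negation. *)
Record literal (Sg : signature) (T : Type) := Lit {
  lit_sign : bool;
  lit_pred : psym Sg;
  lit_args : {ffun 'I_(psym_ar lit_pred) -> T} }.

Notation rlit Sg := (literal Sg (term Sg)).
Notation glit Sg := (literal Sg (gterm Sg)).

Fixpoint occurs {Sg : signature} (x : nat) (t : term Sg) : Prop :=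
  match t with
  | TVar y => x = y
  | TCst _ => False
  | TFun _ ts => exists i, occurs x (ts i)
  | TArith _ ts => exists i, occurs x (ts i)
  end.

(* [evals s t g]: replacing variables according to [s] and then computing the
   arithmetic subterms turns [t] into the ground term [g].  It is functional in
   [g], and there is no such [g] when some arithmetic operation is undefined. *)
Fixpoint evals {Sg : signature} (s : nat -> option (gterm Sg)) (t : term Sg)
    (g : gterm Sg) : Prop :=
  match t with
  | TVar x => s x = Some g
  | TCst c => g = GCst c
  | TFun f ts => exists gs : {ffun 'I_(fsym_ar f) -> gterm Sg},
      (forall i, evals s (ts i) (gs i)) /\ g = GFun f gs
  | TArith a ts => exists (cs : {ffun 'I_(asym_ar a) -> cst Sg}) (c : cst Sg),
      [/\ forall i, evals s (ts i) (GCst (cs i)), asym_val cs = Some c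
        & g = GCst c]
  end.

Definition lit_occurs {Sg : signature} (x : nat) (l : rlit Sg) : Prop :=
  exists i, occurs x (lit_args l i).

Definition lit_evals {Sg : signature} (s : nat -> option (gterm Sg))
    (l : rlit Sg) (g : glit Sg) : Prop :=
  exists gs : {ffun 'I_(psym_ar (lit_pred l)) -> gterm Sg},
    (forall i, evals s (lit_args l i) (gs i)) /\ g = Lit (lit_sign l) gs.

Record set_name (Sg : signature) := SetName {
  sn_vars : seq nat;
  sn_cond : seq (rlit Sg);
  sn_uniq : uniq sn_vars;
  sn_bound : forall x,
    x \in sn_vars <-> exists l, List.In l sn_cond /\ lit_occurs x l }.

Definition subst_of {Sg : signature} (vs : seq nat) (t : seq (gterm Sg)) :
    nat -> option (gterm Sg) :=
  fun x => onth t (index x vs).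

Definition cond_at {Sg : signature} (S : set_name Sg) (t : seq (gterm Sg)) :
    set (glit Sg) :=
  [set g | exists l, List.In l (sn_cond S) /\
                     lit_evals (subst_of (sn_vars S) t) l g].

(* The tuples that may be substituted for the variables of [S]: those of the
   right length for which every literal of the condition becomes ground. *)
Definition admissible {Sg : signature} (S : set_name Sg)
    (t : seq (gterm Sg)) : Prop :=
  size t = size (sn_vars S) /\
  forall l, List.In l (sn_cond S) ->
    exists g, lit_evals (subst_of (sn_vars S) t) l g.

Definition sn_ext {Sg : signature} (S : set_name Sg) (A : set (glit Sg)) :
    set (seq (gterm Sg)) :=
  [set t | admissible S t /\ cond_at S t `<=` A].

Record aggregates (Sg : signature) := Aggregates {
  agg : finType;
  agg_val : agg -> set (seq (gterm Sg)) -> option int }.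

Inductive cmp_op := CGt | CGe | CLt | CLe | CEq | CNe.

Definition cmp_val (o : cmp_op) (a b : int) : bool :=
  match o with
  | CGt => (a > b)%R
  | CGe => (a >= b)%R
  | CLt => (a < b)%R
  | CLe => (a <= b)%R
  | CEq => a == b
  | CNe => a != b
  end.

Inductive set_op := SProper | SSubset | SEqual.

Definition set_op_val {T : Type} (o : set_op) (X Y : set T) : bool :=
  match o with
  | SProper => `[< X `<` Y >]
  | SSubset => `[< X `<=` Y >]
  | SEqual => `[< X = Y >]
  end.

Inductive set_atom (Sg : signature) (F : aggregates Sg) : Type :=
| AggAgg of agg F & set_name Sg & cmp_op & agg F & set_name Sg
| AggNum of agg F & set_name Sg & cmp_op & int
| SetRel of set_name Sg & set_op & set_name Sg.

Definition width {Sg : signature} {F : aggregates Sg} (C : set_atom F) : nat :=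
  match C with
  | AggAgg _ _ _ _ _ => 2
  | AggNum _ _ _ _ => 1
  | SetRel _ _ _ => 2
  end.

Definition sa_name {Sg : signature} {F : aggregates Sg} (C : set_atom F) :
    'I_(width C) -> set_name Sg :=
  match C return 'I_(width C) -> set_name Sg with
  | AggAgg _ S1 _ _ S2 => tnth [tuple S1; S2]
  | AggNum _ S1 _ _ => tnth [tuple S1]
  | SetRel S1 _ S2 => tnth [tuple S1; S2]
  end.

(* The value of C(X_1, ..., X_n) for arbitrary sets of tuples X_i in place of
   the n set names of [C]; [None] means undefined. *)
Definition sa_val {Sg : signature} {F : aggregates Sg} (C : set_atom F) :
    ('I_(width C) -> set (seq (gterm Sg))) -> option bool :=
  match C return ('I_(width C) -> set (seq (gterm Sg))) -> option bool with
  | AggAgg f1 _ o f2 _ => fun X =>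
      if agg_val f1 (X ord0) is Some a then
        if agg_val f2 (X ord_max) is Some b then Some (cmp_val o a b) else None
      else None
  | AggNum f _ o k => fun X =>
      if agg_val f (X ord0) is Some a then Some (cmp_val o a k) else None
  | SetRel _ o _ => fun X => Some (set_op_val o (X ord0) (X ord_max))
  end.

Definition lit_vec {Sg : signature} {F : aggregates Sg} (C : set_atom F) :=
  'I_(width C) -> set (glit Sg).

Definition sat_by {Sg : signature} {F : aggregates Sg} (C : set_atom F)
    (W : lit_vec C) : Prop :=
  sa_val (fun i => sn_ext (sa_name i) (W i)) = Some true.

Definition sa_value_in {Sg : signature} {F : aggregates Sg} (A : set (glit Sg))
    (C : set_atom F) : option bool :=
  sa_val (fun i : 'I_(width C) => sn_ext (sa_name i) A).

Inductive body_elem (Sg : signature) (F : aggregates Sg) : Type :=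
| BPos of glit Sg
| BNot of glit Sg
| BSet of set_atom F.

Arguments BPos {Sg F} _.
Arguments BNot {Sg F} _.
Arguments BSet {Sg F} _.

Record rule (Sg : signature) (F : aggregates Sg) := Rule {
  rule_head : set (glit Sg);
  rule_body : set (body_elem F) }.

Definition program (Sg : signature) (F : aggregates Sg) := set (rule F).

Definition elem_true {Sg : signature} {F : aggregates Sg} (A : set (glit Sg))
    (e : body_elem F) : Prop :=
  match e with
  | BPos l => A l
  | BNot l => ~ A l
  | BSet C => sa_value_in A C = Some true
  end.

Definition head_true {Sg : signature} (A H : set (glit Sg)) : Prop :=
  exists l, H l /\ A l.

Definition rule_sat {Sg : signature} {F : aggregates Sg} (A : set (glit Sg))
    (r : rule F) : Prop :=
  head_true A (rule_head r) \/ ~ (forall e, rule_body r e -> elem_true A e).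

Definition prog_sat {Sg : signature} {F : aggregates Sg} (A : set (glit Sg))
    (P : program F) : Prop :=
  forall r, P r -> rule_sat A r.

Definition consistent {Sg : signature} (A : set (glit Sg)) : Prop :=
  forall (p : psym Sg) (ts : {ffun 'I_(psym_ar p) -> gterm Sg}),
    ~ (A (Lit true ts) /\ A (Lit false ts)).

(* Meant for programs containing neither default negation nor set atoms. *)
Definition basic_answer_set {Sg : signature} {F : aggregates Sg}
    (P : program F) (A : set (glit Sg)) : Prop :=
  [/\ consistent A, prog_sat A P
    & forall B, consistent B -> prog_sat B P -> B `<=` A -> B = A].

Definition is_not {Sg : signature} {F : aggregates Sg} (e : body_elem F) :
    bool :=
  if e is BNot _ then true else false.

Definition is_set_atom {Sg : signature} {F : aggregates Sg}
    (e : body_elem F) : bool :=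
  if e is BSet _ then true else false.

Definition not_reduct {Sg : signature} {F : aggregates Sg}
    (P : program F) (A : set (glit Sg)) : program F :=
  [set r' | exists r,
    [/\ P r, forall l, rule_body r (BNot l) -> ~ A l
      & r' = Rule (rule_head r) [set e | rule_body r e /\ ~~ is_not e]]].

(* Meant for programs without set atoms. *)
Definition answer_set {Sg : signature} {F : aggregates Sg}
    (P : program F) (A : set (glit Sg)) : Prop :=
  basic_answer_set (not_reduct P A) A.

Definition set_atoms_true {Sg : signature} {F : aggregates Sg}
    (A : set (glit Sg)) (r : rule F) : Prop :=
  forall C, rule_body r (BSet C) -> sa_value_in A C = Some true.

(* Removes the rules with a set atom false or undefined in [A]; in the
   remaining rules [r], replaces each set atom [C] by the literals [R r C]. *)
Definition set_reduct {Sg : signature} {F : aggregates Sg} (P : program F)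
    (A : set (glit Sg)) (R : rule F -> set_atom F -> set (glit Sg)) :
    program F :=
  [set r' | exists r,
    [/\ P r, set_atoms_true A r
      & r' = Rule (rule_head r)
          ([set e | rule_body r e /\ ~~ is_set_atom e] `|`
           [set e | exists C l, [/\ rule_body r (BSet C), R r C l & e = BPos l]])]].

Definition alog_support {Sg : signature} {F : aggregates Sg}
    (A : set (glit Sg)) (C : set_atom F) : set (glit Sg) :=
  [set l | exists (i : 'I_(width C)) t,
             sn_ext (sa_name i) A t /\ cond_at (sa_name i) t l].

Definition alog_reduct {Sg : signature} {F : aggregates Sg} (P : program F)
    (A : set (glit Sg)) : program F :=
  set_reduct P A (fun _ C => alog_support A C).

Definition vec_le {Sg : signature} {F : aggregates Sg} {C : set_atom F}
    (W V : lit_vec C) : Prop :=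
  forall i, W i `<=` V i.

Definition vec_lt {Sg : signature} {F : aggregates Sg} {C : set_atom F}
    (W V : lit_vec C) : Prop :=
  vec_le W V /\ W <> V.

Definition support {Sg : signature} {F : aggregates Sg} (A : set (glit Sg))
    (C : set_atom F) (W : lit_vec C) : Prop :=
  (forall i, W i `<=` A) /\
  (forall V : lit_vec C, (forall i, W i `<=` V i /\ V i `<=` A) -> sat_by V).

Definition minimal_support {Sg : signature} {F : aggregates Sg}
    (A : set (glit Sg)) (C : set_atom F) (W : lit_vec C) : Prop :=
  support A W /\ ~ (exists U : lit_vec C, vec_lt U W /\ support A U).

(* [ch] chooses a minimal support for each set atom of each remaining rule; if
   one of these set atoms has no minimal support, there is no set reduct. *)
Definition is_slog_reduct {Sg : signature} {F : aggregates Sg} (P : program F)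
    (A : set (glit Sg)) (Q : program F) : Prop :=
  exists ch : rule F -> forall C : set_atom F, lit_vec C,
    (forall r C, P r -> set_atoms_true A r -> rule_body r (BSet C) ->
       minimal_support A (ch r C)) /\
    Q = set_reduct P A (fun r C => [set l | exists i, ch r C i l]).

Definition alog_answer_set {Sg : signature} {F : aggregates Sg}
    (P : program F) (A : set (glit Sg)) : Prop :=
  answer_set (alog_reduct P A) A.

Definition slog_answer_set {Sg : signature} {F : aggregates Sg}
    (P : program F) (A : set (glit Sg)) : Prop :=
  exists Q, is_slog_reduct P A Q /\ answer_set Q A.

(* Main.v *)
Require Import Defs.
From mathcomp Require Import all_boot boolp classical_sets.
Local Open Scope classical_set_scope.

(** If A1 is contained in A2, then A1 satisfies the reduct of the program with
    respect to A2: when the body of a reduced rule holds in A1, the literals that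
    replaced its set atoms lie in A1, which forces these set atoms to be true in
    A1 already, so the reduct with respect to A1 contains a version of the same
    rule whose body also holds in A1.  Minimality of A2 then gives A1 = A2. *)

(** [R1] and [R2] stay abstract and unrelated, so that one argument covers both semantics, including
    independent choices of minimal supports for [A1] and [A2]. *)
Lemma set_reduct_answer_sets_eq {Sg : signature} {F : aggregates Sg}
    (P : program F) (A1 A2 : set (glit Sg))
    (R1 R2 : rule F -> set_atom F -> set (glit Sg)) :
  (forall r C, P r -> set_atoms_true A1 r -> rule_body r (BSet C) ->
     R1 r C `<=` A1) ->
  (forall r C, P r -> set_atoms_true A2 r -> rule_body r (BSet C) ->
     R2 r C `<=` A1 -> sa_value_in A1 C = Some true) ->
  answer_set (set_reduct P A1 R1) A1 -> answer_set (set_reduct P A2 R2) A2 ->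
  A1 `<=` A2 -> A1 = A2.
Proof.
move=> R1_sub R2_true [cons1 sat1 _] [_ _ min2] A12.
apply: min2 => // _ [_ [[r [Pr true2 ->]] /= not2 ->]].
have [body1|] := pselect (forall e, (rule_body r e /\ ~~ is_set_atom e \/
    exists C l, [/\ rule_body r (BSet C), R2 r C l & e = BPos l]) /\
    ~~ is_not e -> elem_true A1 e); last by right.
left; have true1 : set_atoms_true A1 r.
  move=> C rC; apply: (R2_true r) => // l RCl.
  by apply: (body1 (BPos l)); split=> //; right; exists C, l.
case: (sat1 (Rule (rule_head r) [set e | (rule_body r e /\ ~~ is_set_atom e \/
    exists C l, [/\ rule_body r (BSet C), R1 r C l & e = BPos l]) /\
    ~~ is_not e])) => //=.
- eexists; split; [by exists r | | by []].
  (* A literal under [not] is outside [A2], hence outside [A1]; replaced set atoms contribute only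
     positive literals. *)
  move=> l /= [[rl _]|[C [l' [_ _ //]]]] /A12.
  by apply: not2; left.
- case=> e [[[re not_set]|[C [l [rC R1l ->]]]] not_not] /=.
    by apply: body1; split=> //; left.
  exact: (R1_sub r C).
Qed.

Arguments set_reduct_answer_sets_eq {Sg F P A1 A2 R1 R2}.

Lemma alog_support_sub {Sg : signature} {F : aggregates Sg}
    (A : set (glit Sg)) (C : set_atom F) : alog_support A C `<=` A.
Proof. by move=> l [i [t [[_ tA] /tA]]]. Qed.

(** Each tuple of a set name's extension in [A2] has its condition literals in the support, hence in
    [A1], so the extensions in [A1] and [A2] coincide. *)
Lemma alog_support_value {Sg : signature} {F : aggregates Sg}
    (A1 A2 : set (glit Sg)) (C : set_atom F) :
  A1 `<=` A2 -> alog_support A2 C `<=` A1 ->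
  sa_value_in A1 C = sa_value_in A2 C.
Proof.
move=> A12 supp1; congr sa_val; apply/funext => i.
apply/seteqP; split=> t [adm tA]; split=> // l lt; first exact/A12/tA.
by apply: supp1; exists i, t.
Qed.

Arguments alog_support_value {Sg F A1 A2 C}.

(** The constant vector [A1] lies between [W] and [A2], so it satisfies [C]. *)
Lemma support_value {Sg : signature} {F : aggregates Sg}
    (A1 A2 : set (glit Sg)) (C : set_atom F) (W : lit_vec C) :
  A1 `<=` A2 -> Defs.support A2 W -> (forall i, W i `<=` A1) ->
  sa_value_in A1 C = Some true.
Proof. by move=> A12 [_ satW] WA1; apply: (satW (fun=> A1)). Qed.

Arguments support_value {Sg F A1 A2 C W}.

Theorem proposition2 (Sg : signature) (F : aggregates Sg) (P : program F) :
  ~ (exists A1 A2 : set (glit Sg),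
       [/\ alog_answer_set P A1, alog_answer_set P A2 & A1 `<` A2]) /\
  ~ (exists A1 A2 : set (glit Sg),
       [/\ slog_answer_set P A1, slog_answer_set P A2 & A1 `<` A2]).
Proof.
split.
- case=> A1 [A2 [ans1 ans2 [A12 nA21]]]; apply: nA21.
  rewrite (set_reduct_answer_sets_eq _ _ ans1 ans2 A12) // => r C Pr true_r rC.
    exact: alog_support_sub.
  by move=> /(alog_support_value A12) ->; exact: true_r.
- case=> A1 [A2 [[_ [[ch1 [min1 ->]] ans1]] [_ [[ch2 [min2 ->]] ans2]]]].
  case=> A12 nA21; apply: nA21.
  rewrite (set_reduct_answer_sets_eq _ _ ans1 ans2 A12) // => r C Pr true_r rC.
    by move=> l [i]; have [[sub _] _] := min1 r C Pr true_r rC; exact: sub.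
  (* The union of the coordinates of [ch2 r C] lies in [A1], hence so does each coordinate. *)
  move=> ch2A1; have [supp2 _] := min2 r C Pr true_r rC.
  by apply: (support_value A12 supp2) => i l Wl; apply: ch2A1; exists i.
Qed.
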